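(* Let $G$ be an infinite, connected, vertex-transitive, smallish graph in which every vertex has degree $k$, with a unit resistor on each edge. For every vertex $v$ of $G$ and every positive integer $r$, $$\sum_{j = v_r \sim v_{r-1} \sim \cdots \sim v_0 = v} R_{vj} \;=\; 2k^{r-1}\sum_{s=0}^{r-1}\frac{\Delta_s}{k^s},$$ where the sum on the left runs over all walks $v=v_0\sim v_1\sim\cdots\sim v_r=j$ of length $r$ starting at $v$ (vertices may repeat), and $j$ denotes the endpoint of the walk.
   Context: $x\sim y$ means $x$ and $y$ are adjacent. $R_{xy}$ denotes the effective electrical resistance between vertices $x,y$ when every edge carries unit resistance. $G$ is vertex transitive if for any two vertices there is a graph automorphism mapping one to the other. $G$ is smallish if it has bounded degree and possesses a sequence of finite subgraphs $G_m$ with $G_m\subseteq G_{m+1}$, $\bigcup_m G_m=G$, and $|\mathrm{boundary}(G_m)|/|G_m|\to 0$ as $m\to\infty$ (here $|G_m|$ is the number of vertices of $G_m$ and the boundary consists of the vertices of $G_m$ adjacent to vertices outside $G_m$). $\Delta_s$ denotes the number of walks of length $s$ (all walks, including those repeating vertices) that start and end at a given vertex (independent of the vertex by transitivity), with $\Delta_0=1$. *)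

(* Defs.v *)
From HB Require Import structures.
From mathcomp Require Import all_boot all_order all_algebra.
From mathcomp Require Import all_classical all_reals.
Set Implicit Arguments. Unset Strict Implicit. Unset Printing Implicit Defensive.
Import Order.TTheory GRing.Theory Num.Theory.
Local Open Scope classical_set_scope.
Local Open Scope ring_scope.

Section Graph.
Variables (R : realType) (V : eqType) (nbr : V -> seq V).

Definition adj : rel V := fun u w => w \in nbr u.

Definition simple_graph : Prop :=
  [/\ forall u, uniq (nbr u),
      forall u, u \notin nbr u &
      forall u w, (w \in nbr u) = (u \in nbr w)].

Definition regular (k : nat) : Prop := forall u, size (nbr u) = k.

Definition infinite_graph : Prop := ~ exists s : seq V, forall x, x \in s.

Definition connected_graph : Prop :=
  forall x y, exists p : seq V, path adj x p /\ last x p = y.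

Definition automorphism (phi : V -> V) : Prop :=
  bijective phi /\ forall a b, adj (phi a) (phi b) = adj a b.

Definition vertex_transitive : Prop :=
  forall x y, exists phi, automorphism phi /\ phi x = y.

(* finite vertex sets are given by sequences *)
Definition boundary (S : seq V) : seq V :=
  [seq x <- undup S | has (fun w => w \notin S) (nbr x)].

Definition smallish_exhaustion (Gm : nat -> seq V) : Prop :=
  [/\ forall m x, x \in Gm m -> x \in Gm m.+1,
      forall x, exists m, x \in Gm m &
      forall eps : R, 0 < eps -> exists M, forall m, (M <= m)%N ->
        (size (boundary (Gm m)))%:R / (size (undup (Gm m)))%:R < eps].

(* bounded degree is provided by k-regularity in the theorem *)
Definition smallish : Prop := exists Gm, smallish_exhaustion Gm.

(* Dirichlet energy of f on the subgraph induced by the finite set S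
   (unit resistors; every edge counted once). *)
Definition energy (S : seq V) (f : V -> R) : R :=
  2^-1 * \sum_(u <- undup S) \sum_(w <- nbr u | w \in S) (f u - f w) ^+ 2.

(* effective resistance between x and y in the finite induced subgraph S,
   via the Dirichlet principle: R = sup_f (f x - f y)^2 / E_S(f). *)
Definition res_fin (S : seq V) (x y : V) : R :=
  sup [set (f x - f y) ^+ 2 / energy S f | f in [set f | 0 < energy S f]].

Definition joined_in (S : seq V) (x y : V) : Prop :=
  x \in S /\ exists p : seq V, path adj x p /\ last x p = y /\ all (mem S) p.

(* effective resistance in the infinite graph: infimum (= limit along any
   exhaustion, by Rayleigh monotonicity) of finite induced resistances. *)
Definition eff_res (x y : V) : R :=
  inf [set res_fin S x y | S in [set S | joined_in S x y]].

Fixpoint walk_sum (r : nat) (v : V) (g : V -> R) : R :=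
  if r is r'.+1 then \sum_(u <- nbr v) walk_sum r' u g else g v.

Definition Delta (v : V) (s : nat) : R := walk_sum s v (fun j => (j == v)%:R).

End Graph.

(* Main.v *)
Require Import Defs.
From HB Require Import structures.
From mathcomp Require Import all_boot all_order all_algebra.
From mathcomp Require Import all_classical all_reals.
From mathcomp Require Import ring lra.
Import Order.TTheory GRing.Theory Num.Theory.
Local Open Scope ring_scope.

Set Implicit Arguments.
Unset Strict Implicit.
Unset Printing Implicit Defensive.

(** Let q_s = Delta_s / k^s be the return probabilities of simple random walk
    and W the left-hand side.

    Upper bound.  On a finite vertex set S let P be the symmetric stochastic
    matrix of the walk that stays put whenever it would leave S.  If Q is a
    one-sided inverse of 1 - P on its row space, the Dirichlet principle gives
    k R_S(x,y) <= Q_xx + Q_yy - Q_xy - Q_yx, hence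
      k sum_xy (P^r)_xy R_S(x,y) <= 2 tr((1 - P^r) Q)
                                 = 2 sum_(s<r) tr(P^s (1 - P) Q)
                                <= 2 sum_(s<r) tr(P^s),
    because 1 - (1 - P) Q is idempotent and absorbed by P.  Along the exhaustion
    all but o(|S|) vertices are at distance > r from the complement of S; for
    them the x-th row of the left side is at least k W / k^r (resistances only
    decrease from S to the whole graph) and (P^s)_xx = q_s.

    Lower bound.  Testing the Dirichlet principle with the truncated Green
    function sum_(s<2b) P^s (delta_v - delta_x) / k gives
      k R(v,x) >= 2 sum_(s<2b) (p_s(v,v) - p_s(v,x));
    summing over walks of length r the right-hand side telescopes to
    the claimed value up to an error O(q_2b), which tends to 0 as the graph is
    infinite: p_2b(v,w) <= q_2b, with almost equality for every w at a fixed
    even walk distance once q_2b has nearly converged, so a positive limit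
    would contradict sum_w p_2b(v,w) = 1. *)

(** * Symmetric stochastic matrices *)

Definition qform (R : pzRingType) n (M : 'M[R]_n) (g : 'rV[R]_n) : R :=
  (g *m M *m g^T) 0 0.

Lemma qformD (R : pzRingType) n (A B : 'M[R]_n) g :
  qform (A + B) g = qform A g + qform B g.
Proof. by rewrite /qform mulmxDr mulmxDl mxE. Qed.

Lemma qform_sum (R : pzRingType) n (I : Type) (s : seq I) (F : I -> 'M[R]_n) g :
  qform (\sum_(i <- s) F i) g = \sum_(i <- s) qform (F i) g.
Proof. by rewrite /qform mulmx_sumr mulmx_suml summxE. Qed.

Lemma qform_mulmx (R : comPzRingType) n (M N : 'M[R]_n) g :
  qform M (g *m N) = qform (N *m M *m N^T) g.
Proof. by rewrite /qform trmx_mul !mulmxA. Qed.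

Lemma qformZ (R : comNzRingType) n (M : 'M[R]_n) a g :
  qform M (a *: g) = a ^+ 2 * qform M g.
Proof.
rewrite /qform; have -> : (a *: g)^T = a *: g^T.
  by apply/matrixP => i j; rewrite !mxE.
by rewrite -scalemxAr -!scalemxAl scalerA mxE expr2.
Qed.

Lemma qformBZ (R : comNzRingType) n (M : 'M[R]_n) (g u : 'rV_n) t :
  qform M (g - t *: u) = qform M g - t * (g *m M *m u^T) 0 0
                         - t * (u *m M *m g^T) 0 0 + t ^+ 2 * qform M u.
Proof.
rewrite /qform; have -> : (g - t *: u)^T = g^T - t *: u^T.
  by apply/matrixP => i j; rewrite !mxE.
rewrite mulmxBr !mulmxBl.
rewrite -!scalemxAl -!scalemxAr.
have subE (A B : 'M[R]_1) : (A - B) 0 0 = A 0 0 - B 0 0 by rewrite !mxE.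
have scaleE a (A : 'M[R]_1) : (a *: A) 0 0 = a * A 0 0 by rewrite mxE.
by rewrite !subE !scaleE; ring.
Qed.

Lemma qform_delta (R : comNzRingType) n (M : 'M[R]_n) i j :
  qform M (delta_mx 0 i - delta_mx 0 j) = M i i + M j j - M i j - M j i.
Proof.
rewrite /qform mulmxBl -!rowE linearB /= !trmx_delta mulmxBr !mulmxBl -!colE.
by rewrite !mxE; ring.
Qed.

Lemma mulmx_delta_diff (R : nzRingType) n (u : 'rV[R]_n) i j :
  (u *m (delta_mx 0 i - delta_mx 0 j : 'rV_n)^T) 0 0 = u 0 i - u 0 j.
Proof. by rewrite [(_ - _)^T]linearB /= mulmxBr !trmx_delta -!colE !mxE. Qed.

(** In a full-rank factorisation [E = C *m B], idempotence forces [B *m C = 1], so the trace is the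
    rank. *)
Lemma mxtrace_idem_ge0 (R : realFieldType) n (E : 'M[R]_n) :
  E *m E = E -> 0 <= \tr E.
Proof.
move=> EE; suff -> : \tr E = (\rank E)%:R by apply: ler0n.
move: (col_base E) (row_base E) (mulmx_base E)
  (col_base_full E) (row_base_free E).
move=> C B CB Cfull Bfree; rewrite -[in \tr _]CB mxtrace_mulC.
suff -> : B *m C = 1%:M by rewrite mxtrace1.
apply: (row_full_inj Cfull); apply: (row_free_inj Bfree) => /=.
by rewrite mulmx1 mulmxA CB -mulmxA CB EE.
Qed.

Section StochasticMatrix.
Variables (R : realFieldType) (n : nat) (P : 'M[R]_n).
Hypotheses (Psym : P^T = P) (P_ge0 : forall i j, 0 <= P i j)
           (Psum : forall i, \sum_j P i j = 1).

Lemma expmx_tr s : (P ^+ s)^T = P ^+ s.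
Proof.
elim: s => [|s IH]; first by rewrite !expr0 trmx1.
by rewrite exprSr trmx_mul IH Psym -[LHS]/(P * P ^+ s) -exprS exprSr.
Qed.

Lemma expmx_ge0 s i j : 0 <= (P ^+ s) i j.
Proof.
elim: s i j => [|s IH] i j; first by rewrite expr0 mxE ler0n.
by rewrite exprS mxE; apply: sumr_ge0 => l _; apply: mulr_ge0.
Qed.

Lemma expmx_sum s i : \sum_j (P ^+ s) i j = 1.
Proof.
elim: s i => [|s IH] i.
  rewrite expr0 (bigD1 i) //= big1 => [|j ji]; rewrite mxE ?eqxx ?addr0 //.
  by rewrite eq_sym (negbTE ji).
under eq_bigr => j _ do rewrite exprS mxE.
rewrite exchange_big /= -[RHS](Psum i); apply: eq_bigr => l _.
by rewrite -mulr_sumr IH mulr1.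
Qed.

Lemma expmx_le1 s i j : (P ^+ s) i j <= 1.
Proof.
rewrite -(expmx_sum s i) (bigD1 j) //= lerDl.
by apply: sumr_ge0 => l _; apply: expmx_ge0.
Qed.

Lemma mx_sqnormE (u : 'rV[R]_n) : (u *m u^T) 0 0 = \sum_i u 0 i ^+ 2.
Proof. by rewrite mxE; apply: eq_bigr => i _; rewrite mxE expr2. Qed.

(** [e = -1] gives the Dirichlet form of [1 - P], and [e = 1] shows that [1 + P] is positive
    semidefinite. *)
Lemma dirichlet_sign (e : R) (u : 'rV[R]_n) : e ^+ 2 = 1 ->
  qform (1 + e *: P) u
  = 2^-1 * \sum_i \sum_j P i j * (u 0 i + e * u 0 j) ^+ 2.
Proof.
rewrite /qform => e2.
have rows : \sum_i \sum_j P i j * u 0 i ^+ 2 = \sum_i u 0 i ^+ 2.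
  by apply: eq_bigr => i _; rewrite -mulr_suml Psum mul1r.
have cols : \sum_i \sum_j P i j * u 0 j ^+ 2 = \sum_i u 0 i ^+ 2.
  rewrite -rows exchange_big /=; apply: eq_bigr => i _; apply: eq_bigr => j _.
  by rewrite -{1}Psym mxE.
have -> : \sum_i \sum_j P i j * (u 0 i + e * u 0 j) ^+ 2
   = \sum_i \sum_j P i j * u 0 i ^+ 2
     + (\sum_i \sum_j P i j * u 0 j ^+ 2
     + 2 * (e * \sum_i \sum_j u 0 i * P i j * u 0 j)).
  rewrite !mulr_sumr -!big_split /=; apply: eq_bigr => i _.
  rewrite !mulr_sumr -!big_split /=; apply: eq_bigr => j _.
  by rewrite sqrrD exprMn e2; ring.
rewrite rows cols mulmxDr mulmxDl mulmx1 [LHS]mxE mx_sqnormE -scalemxAr.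
rewrite -scalemxAl [X in _ + X = _]mxE.
have -> : (u *m P *m u^T) 0 0 = \sum_i \sum_j u 0 i * P i j * u 0 j.
  rewrite mxE exchange_big /=; apply: eq_bigr => j _.
  by rewrite !mxE mulr_suml.
by field.
Qed.

Lemma dirichletE (u : 'rV[R]_n) : qform (1 - P) u
  = 2^-1 * \sum_i \sum_j P i j * (u 0 i - u 0 j) ^+ 2.
Proof.
rewrite -[- P]scaleN1r dirichlet_sign; last by rewrite sqrrN expr1n.
congr (_ * _); apply: eq_bigr => i _; apply: eq_bigr => j _.
by rewrite mulN1r.
Qed.

Lemma dirichlet_ge0 u : 0 <= qform (1 - P) u.
Proof.
rewrite dirichletE mulr_ge0 ?invr_ge0 ?ler0n //.
by do 2![apply: sumr_ge0 => ? _]; rewrite mulr_ge0 ?sqr_ge0.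
Qed.

Lemma qform_even_ge0 b g : 0 <= qform (P ^+ (b + b)) g.
Proof.
have -> : P ^+ (b + b) = P ^+ b *m 1 *m (P ^+ b)^T.
  by rewrite mulmx1 expmx_tr exprD.
rewrite -qform_mulmx /qform mulmx1 mx_sqnormE.
by apply: sumr_ge0 => i _; rewrite sqr_ge0.
Qed.

Lemma qform_even_odd_ge0 b g :
  0 <= qform (P ^+ (b + b)) g + qform (P ^+ (b + b).+1) g.
Proof.
have <- : qform (1 + 1 *: P) (g *m P ^+ b)
          = qform (P ^+ (b + b)) g + qform (P ^+ (b + b).+1) g.
  rewrite qform_mulmx -qformD expmx_tr scale1r; congr qform.
  by rewrite mulmxDr mulmxDl mulmx1 !mulmxE -exprD -exprSr -exprD.
rewrite dirichlet_sign ?expr1n // mulr_ge0 ?invr_ge0 ?ler0n //.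
by do 2![apply: sumr_ge0 => ? _]; rewrite mulr_ge0 ?sqr_ge0.
Qed.

(* Even powers of P are positive semidefinite, and so is each pair
   P^(2c) + P^(2c+1), which is why the number of terms is taken even. *)
Lemma dirichlet_truncated_green b g (M := \sum_(s < b + b) P ^+ s) :
  qform (1 - P) (g *m M) <= qform M g.
Proof.
have Mtr : M^T = M.
  by rewrite /M linear_sum; apply: eq_bigr => s _; apply: expmx_tr.
have LM : (1 - P) * M = 1 - P ^+ (b + b).
  by rewrite -[1 - P]opprB mulNr -subrX1 opprB.
have comM : M * (1 - P) = (1 - P) * M.
  rewrite mulr_suml mulr_sumr; apply: eq_bigr => s _.
  by rewrite mulrBl mulrBr mul1r mulr1 -exprS -exprSr.
(* By telescoping the left side is the form of [M - P ^+ (b + b) * M]; it remains to see that the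
   subtracted part is nonnegative. *)
rewrite qform_mulmx Mtr mulmxE comM LM mulrBl mul1r.
have -> : qform M g = qform (M - P ^+ (b + b) * M) g
                      + qform (P ^+ (b + b) * M) g.
  by rewrite -qformD subrK.
rewrite lerDl mulr_sumr qform_sum -(big_mkord xpredT
  (fun s => qform (P ^+ (b + b) * P ^+ s) g)).
suff H c : 0 <= \sum_(0 <= s < c + c) qform (P ^+ (b + b) * P ^+ s) g.
  exact: H.
elim: c => [|c IH]; first by rewrite big_geq.
rewrite addSn addnS !big_nat_recr //= -addrA addr_ge0 //.
by rewrite -!exprD addnS [(b + b + (c + c))%N]addnACA qform_even_odd_ge0.
Qed.

(** Symmetry of [pinvmx] is avoided: both sides pair [g] with its potential [g *m pinvmx (1 - P)],
    up to transposing a 1 by 1 matrix. *)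
Lemma pinv_qform (g : 'rV[R]_n) : (g <= (1 - P : 'M_n))%MS ->
  qform (pinvmx (1 - P)) g = qform (1 - P) (g *m pinvmx (1 - P)).
Proof.
move=> gL; rewrite /qform mulmxKpV //.
have trE (A : 'M[R]_1) : A 0 0 = A^T 0 0 by rewrite mxE.
by rewrite [RHS]trE trmx_mul trmxK.
Qed.

(** Writing [g = h *m L] turns this into the Cauchy-Schwarz inequality for the semidefinite form of
    [L]. *)
Lemma pinv_cauchy_schwarz (g u : 'rV[R]_n) : (g <= (1 - P : 'M_n))%MS ->
  0 < qform (1 - P) u ->
  (u *m g^T) 0 0 ^+ 2 / qform (1 - P) u <= qform (pinvmx (1 - P)) g.
Proof.
have trE (A : 'M[R]_1) : A 0 0 = A^T 0 0 by rewrite mxE.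
set L : 'M_n := 1 - P => gL E0; set h := g *m pinvmx L.
have Ltr : L^T = L by rewrite /L linearB /= trmx1 Psym.
have hL : h *m L = g by apply: mulmxKpV.
rewrite pinv_qform // -/L -/h; clearbody h.
have -> : u *m g^T = u *m L *m h^T by rewrite -hL trmx_mul Ltr mulmxA.
(* [t] minimises the form at [h - t *: u]. *)
set B := (u *m L *m h^T) 0 0; set t := B / qform L u.
have B' : (h *m L *m u^T) 0 0 = B.
  by rewrite [LHS]trE !trmx_mul Ltr trmxK mulmxA.
have := dirichlet_ge0 (h - t *: u); rewrite -/L.
have -> : qform L (h - t *: u) = qform L h - 2 * t * B + t ^+ 2 * qform L u.
  by rewrite qformBZ B' -/B; ring.
have -> : qform L h - 2 * t * B + t ^+ 2 * qform L u
          = qform L h - B ^+ 2 / qform L u.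
  by rewrite /t; field; rewrite gt_eqF.
by rewrite subr_ge0.
Qed.

(** A column of the cokernel has zero Dirichlet energy, hence equal values at [i] and [j] when
    [P i j] is nonzero. *)
Lemma edge_rowspace i j : P i j != 0 ->
  ((delta_mx 0 i - delta_mx 0 j : 'rV_n) <= (1 - P : 'M_n))%MS.
Proof.
move=> Pij; rewrite submxE; apply/eqP/rowP => c.
set C := cokermx _; pose u := (col c C)^T.
have u0 : qform (1 - P) u = 0.
  rewrite /qform /u -[1 - P]trmxK [(1 - P)^T]linearB /= trmx1 Psym -trmx_mul.
  by rewrite colE mulmxA mulmx_coker mul0mx trmx0 mul0mx mxE.
move: u0; rewrite dirichletE => /eqP; rewrite mulf_eq0 invr_eq0 pnatr_eq0 /=.
have sq a b : 0 <= P a b * (u 0 a - u 0 b) ^+ 2 by rewrite mulr_ge0 ?sqr_ge0.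
rewrite psumr_eq0 => [|a _]; last by apply: sumr_ge0.
move=> /allP/(_ i); rewrite mem_index_enum => /(_ isT) /=.
rewrite psumr_eq0 // => /allP/(_ j); rewrite mem_index_enum => /(_ isT) /=.
rewrite mulf_eq0 (negbTE Pij) /= sqrf_eq0 subr_eq0 => /eqP uij.
rewrite mulmxBl -!rowE !mxE.
by move: uij; rewrite !mxE => ->; rewrite subrr.
Qed.

Lemma sum_expmx_pinv r (Q := pinvmx (1 - P)) :
  \sum_i \sum_j (P ^+ r) i j * qform Q (delta_mx 0 i - delta_mx 0 j)
  <= 2 * \sum_(s < r) \tr (P ^+ s).
Proof.
set L : 'M_n := 1 - P.
have LQL : L *m Q *m L = L by apply: mulmxKpV.
(* [E] measures how far [Q] is from inverting [L]; it kills [L], so it is idempotent and absorbs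
   powers of [P]. *)
pose E := 1 - L *m Q.
have EL : E *m L = 0 by rewrite mulmxBl mul1mx LQL subrr.
have EE : E *m E = E by rewrite {2}/E mulmxBr mulmx1 mulmxA EL mul0mx subr0.
have EP s : E *m P ^+ s = E.
  elim: s => [|s IH]; first by rewrite mulmx1.
  rewrite exprS -mulmxE mulmxA; suff -> : E *m P = E by [].
  by rewrite -[P](subKr 1) -/L mulmxBr EL mulmx1 subr0.
have trE s : \tr (P ^+ s *m (L *m Q)) <= \tr (P ^+ s).
  rewrite -subr_ge0 -linearB /= -{1}[P ^+ s]mulmx1 -mulmxBr -/E.
  by rewrite mxtrace_mulC EP mxtrace_idem_ge0.
(* Rows and columns of [P ^+ r] sum to one, so each diagonal part gives [\tr Q]; by symmetry each
   cross part gives [\tr (P ^+ r *m Q)]. *)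
have -> : \sum_i \sum_j (P ^+ r) i j * qform Q (delta_mx 0 i - delta_mx 0 j)
          = 2 * (\tr Q - \tr (P ^+ r *m Q)).
  have d1 : \sum_i \sum_j (P ^+ r) i j * Q i i = \tr Q.
    by apply: eq_bigr => i _; rewrite -mulr_suml expmx_sum mul1r.
  have d2 : \sum_i \sum_j (P ^+ r) i j * Q j j = \tr Q.
    rewrite exchange_big /= -d1; apply: eq_bigr => i _; apply: eq_bigr => j _.
    by rewrite -{1}expmx_tr mxE.
  have d3 : \sum_i \sum_j (P ^+ r) i j * Q j i = \tr (P ^+ r *m Q).
    by apply: eq_bigr => i _; rewrite mxE.
  have d4 : \sum_i \sum_j (P ^+ r) i j * Q i j = \tr (P ^+ r *m Q).
    rewrite exchange_big /= -d3; apply: eq_bigr => i _; apply: eq_bigr => j _.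
    by rewrite -{1}expmx_tr mxE.
  transitivity (\sum_i \sum_j (P ^+ r) i j * Q i i
    + \sum_i \sum_j (P ^+ r) i j * Q j j
    - \sum_i \sum_j (P ^+ r) i j * Q i j
    - \sum_i \sum_j (P ^+ r) i j * Q j i); last by rewrite d1 d2 d3 d4; ring.
  rewrite -!sumrN -!big_split /=; apply: eq_bigr => i _.
  rewrite -!sumrN -!big_split /=; apply: eq_bigr => j _.
  by rewrite qform_delta; ring.
rewrite ler_pM2l ?ltr0n // -linearB /= -{1}[Q]mul1mx -mulmxBl.
have -> : 1 - P ^+ r = (\sum_(s < r) P ^+ s) *m L.
  rewrite -opprB subrX1 -mulNr opprB mulr_sumr mulmx_suml.
  apply: eq_bigr => s _.
  by rewrite mulmxBr mulrBl mulmx1 mul1r mulmxE -exprS -exprSr.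
rewrite -mulmxA mulmx_suml linear_sum; apply: ler_sum => s _; exact: trE.
Qed.

End StochasticMatrix.

(** * Walks and automorphisms *)

Section Walks.
Variables (R : realType) (V : eqType) (nbr : V -> seq V) (k : nat).
Hypotheses (Hsimple : simple_graph nbr) (Hreg : regular nbr k).
Implicit Types (x y z : V) (g h : V -> R).

Lemma walk_sum_cat s t x g :
  walk_sum nbr (s + t) x g = walk_sum nbr s x (fun z => walk_sum nbr t z g).
Proof. by elim: s x => [|s IH] x //=; apply: eq_bigr => u _; apply: IH. Qed.

Lemma eq_walk_sum s x g h : g =1 h -> walk_sum nbr s x g = walk_sum nbr s x h.
Proof. by move=> gh; elim: s x => [|s IH] x /=; [|apply: eq_bigr]. Qed.

Lemma walk_sumD s x g h : walk_sum nbr s x (fun z => g z + h z)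
  = walk_sum nbr s x g + walk_sum nbr s x h.
Proof.
by elim: s x => [|s IH] x //=; rewrite -big_split; apply: eq_bigr => u _.
Qed.

Lemma walk_sumZ s x a g : walk_sum nbr s x (fun z => a * g z)
  = a * walk_sum nbr s x g.
Proof.
by elim: s x => [|s IH] x //=; rewrite mulr_sumr; apply: eq_bigr => u _.
Qed.

Lemma walk_sum_sum (I : Type) (r : seq I) (F : I -> V -> R) s x :
  walk_sum nbr s x (fun z => \sum_(i <- r) F i z)
  = \sum_(i <- r) walk_sum nbr s x (F i).
Proof.
elim: s x => [|s IH] x //=.
by rewrite exchange_big /=; apply: eq_bigr => u _.
Qed.

Lemma le_walk_sum s x g h : (forall z, g z <= h z) ->
  walk_sum nbr s x g <= walk_sum nbr s x h.
Proof. by move=> gh; elim: s x => [|s IH] x //=; apply: ler_sum. Qed.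

Lemma walk_sum_ge0 s x g : (forall z, 0 <= g z) -> 0 <= walk_sum nbr s x g.
Proof. by move=> g0; elim: s x => [|s IH] x //=; apply: sumr_ge0. Qed.

Lemma walk_sum_cst s x (a : R) : walk_sum nbr s x (fun=> a) = k%:R ^+ s * a.
Proof.
elim: s x => [|s IH] x /=; first by rewrite mul1r.
rewrite (eq_bigr _ (fun u _ => IH u)) big_const_seq count_predT Hreg.
by rewrite iter_addr_0 -[LHS]mulr_natl exprS mulrA.
Qed.

Lemma automorphism_nbr phi x : automorphism nbr phi ->
  perm_eq (nbr (phi x)) (map phi (nbr x)).
Proof.
case: Hsimple => nuniq _ _ [[psi phiK psiK] phiE].
apply: uniq_perm; rewrite ?map_inj_uniq //; first exact: can_inj phiK.
move=> w; rewrite -{1}[w]psiK -/(adj nbr (phi x) _) phiE /adj.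
by rewrite -{2}[w]psiK mem_map //; apply: can_inj phiK.
Qed.

Lemma automorphism_inv phi psi : automorphism nbr phi ->
  cancel phi psi -> cancel psi phi -> automorphism nbr psi.
Proof.
move=> [_ phiE] phiK psiK; split; first by exists phi.
by move=> a b; rewrite -phiE !psiK.
Qed.

Lemma walk_sum_automorphism phi s x g : automorphism nbr phi ->
  walk_sum nbr s (phi x) g = walk_sum nbr s x (g \o phi).
Proof.
move=> aphi; elim: s x => [|s IH] x //=.
by rewrite (perm_big _ (automorphism_nbr x aphi)) big_map; apply: eq_bigr.
Qed.

Lemma Delta_transitive s x y : vertex_transitive nbr ->
  Delta R nbr x s = Delta R nbr y s.
Proof.
move=> /(_ x y) [phi [aphi <-]]; rewrite /Delta walk_sum_automorphism //.
apply: eq_walk_sum => z /=; rewrite inj_eq //.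
by case: aphi => /bij_inj.
Qed.

Lemma energy_automorphism phi S (f : V -> R) : automorphism nbr phi ->
  energy nbr (map phi S) f = energy nbr S (f \o phi).
Proof.
move=> aphi; have phiI : injective phi by case: aphi => /bij_inj.
rewrite /energy undup_map_inj // big_map; congr (_ * _).
apply: eq_bigr => u _; rewrite (perm_big _ (automorphism_nbr u aphi)) big_map.
by apply: eq_bigl => w; rewrite mem_map.
Qed.

Lemma res_fin_automorphism phi S x y : automorphism nbr phi ->
  res_fin R nbr (map phi S) (phi x) (phi y) = res_fin R nbr S x y.
Proof.
move=> aphi; case: (aphi) => [[psi phiK psiK] _].
rewrite /res_fin; congr sup; apply/seteqP; split => _ [f /= f0 <-].
  by exists (f \o phi); rewrite /= -energy_automorphism.
have fE : energy nbr (map phi S) (f \o psi) = energy nbr S f.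
  rewrite energy_automorphism //; congr energy; apply/funext => z /=.
  by rewrite phiK.
by exists (f \o psi); rewrite /= fE // !phiK.
Qed.

Lemma joined_in_automorphism phi S x y : automorphism nbr phi ->
  joined_in nbr S x y -> joined_in nbr (map phi S) (phi x) (phi y).
Proof.
move=> [_ phiE] [xS [p [pp [lp pS]]]]; split; first exact: map_f.
exists (map phi p); split; last split.
- by rewrite path_map (eq_path phiE).
- by rewrite last_map lp.
- by rewrite all_map; apply: sub_all pS => z; apply: map_f.
Qed.

Lemma eff_res_automorphism phi x y : automorphism nbr phi ->
  eff_res R nbr (phi x) (phi y) = eff_res R nbr x y.
Proof.
move=> aphi; case: (aphi) => [[psi phiK psiK] _].
have apsi := automorphism_inv aphi phiK psiK.
rewrite /eff_res; congr inf; apply/seteqP; split => _ [S /= jS <-].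
  exists (map psi S).
    by rewrite /= -(phiK x) -(phiK y); apply: joined_in_automorphism.
  by rewrite -{1}(phiK x) -{1}(phiK y) res_fin_automorphism.
exists (map phi S); first exact: joined_in_automorphism.
exact: res_fin_automorphism.
Qed.

(** This lets the average over the vertices of a finite set be compared with the walk sum at one
    vertex. *)
Lemma walk_sum_eff_res_transitive r x y : vertex_transitive nbr ->
  walk_sum nbr r x (eff_res R nbr x) = walk_sum nbr r y (eff_res R nbr y).
Proof.
move=> /(_ x y) [phi [aphi <-]]; rewrite walk_sum_automorphism //.
by apply: eq_walk_sum => z /=; rewrite eff_res_automorphism.
Qed.

End Walks.

(** * Compression to a finite vertex set *)

Section Compression.
Variables (R : realType) (V : eqType) (nbr : V -> seq V) (k : nat).
Hypotheses (Hsimple : simple_graph nbr) (Hreg : regular nbr k).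
Hypothesis k_gt0 : (0 < k)%N.
Variable S : seq V.
Local Notation N := (size (undup S)).

Let k0 : (k%:R : R) != 0. Proof. by rewrite pnatr_eq0 -lt0n. Qed.

Definition site (i : 'I_N) : V := tnth (in_tuple (undup S)) i.

Lemma mem_site i : site i \in S.
Proof. by rewrite -mem_undup mem_tnth. Qed.

Lemma siteP x : x \in S -> exists i, site i = x.
Proof.
rewrite -mem_undup => xS.
by have /tnthP [i ->] : x \in in_tuple (undup S) by []; exists i.
Qed.

Lemma site_inj : injective site.
Proof. by apply/tuple_uniqP; apply: undup_uniq. Qed.

Lemma sum_site (F : V -> R) : \sum_(u <- undup S) F u = \sum_i F (site i).
Proof. exact: big_tnth. Qed.

(* Transition matrix of the walk that stays put whenever it would leave S. *)
Definition stay_mx : 'M[R]_N := \matrix_(i, j)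
  (((site j \in nbr (site i))
    + (i == j) * count (fun w => w \notin S) (nbr (site i)))%N%:R / k%:R).

(** A step to a neighbour outside [S] is replaced by staying at [site i], so a row averages over all
    neighbours. *)
Lemma stay_mx_row (F : V -> R) i : \sum_j stay_mx i j * F (site j)
  = k%:R^-1 * \sum_(w <- nbr (site i)) if w \in S then F w else F (site i).
Proof.
case: Hsimple => nuniq _ _.
have inS : \sum_j (site j \in nbr (site i))%:R * F (site j)
           = \sum_(w <- nbr (site i) | w \in S) F w.
  rewrite -(sum_site (fun u => (u \in nbr (site i))%:R * F u)).
  transitivity (\sum_(u <- undup S | u \in nbr (site i)) F u).
    rewrite [RHS]big_mkcond; apply: eq_bigr => u _.
    by case: ifP; rewrite ?mul1r ?mul0r.
  rewrite -big_filter -[RHS]big_filter; apply: perm_big; apply: uniq_perm.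
  - by rewrite filter_uniq ?undup_uniq.
  - by rewrite filter_uniq.
  - by move=> w; rewrite !mem_filter mem_undup andbC.
have outS : \sum_j (i == j)%:R * F (site j) = F (site i).
  rewrite (bigD1 i) //= eqxx mul1r big1 ?addr0 // => j ji.
  by rewrite eq_sym (negbTE ji) mul0r.
rewrite (bigID (fun w => w \in S)) /=.
rewrite (eq_bigr F) => [|w ->] //; rewrite -inS.
rewrite [X in _ + X](eq_bigr (fun=> F (site i))) => [|w /negbTE ->] //.
rewrite big_const_seq iter_addr_0 -outS -sumrMnl -big_split mulr_sumr /=.
apply: eq_bigr => j _; rewrite mxE natrD natrM -[X in _ * (_ + X)]mulr_natr.
by rewrite [in LHS]mulrC; ring.
Qed.

Lemma stay_mx_sym : stay_mx^T = stay_mx.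
Proof.
case: Hsimple => _ _ nsym; apply/matrixP => i j; rewrite !mxE nsym.
by case: eqVneq => [->|ij]; rewrite // eq_sym (negbTE ij).
Qed.

Lemma stay_mx_ge0 i j : 0 <= stay_mx i j.
Proof. by rewrite mxE divr_ge0 ?ler0n. Qed.

Lemma stay_mx_sum i : \sum_j stay_mx i j = 1.
Proof.
under eq_bigr => j _ do rewrite -[stay_mx i j]mulr1.
rewrite (stay_mx_row (fun=> 1)) (eq_bigr (fun=> 1)) => [|w _].
  by rewrite big_const_seq count_predT Hreg iter_addr_0 mulVf.
by case: ifP.
Qed.

(** A blocked step keeps the value of [f] and costs no energy; the factor [k] undoes the
    normalisation of [stay_mx]. *)
Lemma energyE (f : V -> R) :
  energy nbr S f = k%:R * qform (1 - stay_mx) (\row_i f (site i)).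
Proof.
rewrite dirichletE; [|exact: stay_mx_sym|exact: stay_mx_sum].
rewrite mulrCA mulr_sumr /energy sum_site; congr (_ * _).
apply: eq_bigr => i _.
rewrite (eq_bigr (fun j => stay_mx i j * (f (site i) - f (site j)) ^+ 2)).
  rewrite (stay_mx_row (fun z => (f (site i) - f z) ^+ 2)).
  rewrite mulVKf // big_mkcond /=; apply: eq_bigr => w _.
  by case: ifP => //; rewrite subrr expr0n.
by move=> j _; rewrite !mxE.
Qed.

Lemma energy_ge0 (f : V -> R) : 0 <= energy nbr S f.
Proof.
rewrite mulr_ge0 ?invr_ge0 ?ler0n //.
by do 2![apply: sumr_ge0 => ? _]; rewrite sqr_ge0.
Qed.

(** All walks of at most [s] steps from [x] remain in [S]. *)
Fixpoint interior s (x : V) : bool :=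
  (x \in S) && if s is s'.+1 then all (interior s') (nbr x) else true.

Lemma interior_mem s x : interior s x -> x \in S.
Proof. by case: s => [|s] /= /andP []. Qed.

Lemma interiorS s x : interior s.+1 x -> interior s x.
Proof.
elim: s x => [|s IH] x; first by case/andP => /= ->.
case/andP => xS xn; rewrite /= xS /=; apply: sub_all xn; exact: IH.
Qed.

Lemma interior_leq s t x : (s <= t)%N -> interior t x -> interior s x.
Proof.
move/subnK <-; elim: (t - s)%N => // d IH.
by rewrite addSn => /interiorS; apply: IH.
Qed.

Lemma stay_mx_neq0 i j : stay_mx i j != 0 -> i = j \/ site j \in nbr (site i).
Proof.
rewrite mxE; case: (eqVneq i j) => [->|ij]; first by left.
by case: (site j \in _); [right|rewrite mul0r eqxx].
Qed.

(** None of the first [s] steps from an [s]-interior vertex is blocked, so the compressed walk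
    agrees with simple random walk. *)
Lemma stay_mx_walk s i (g : V -> R) : interior s (site i) ->
  \sum_j (stay_mx ^+ s) i j * g (site j)
  = walk_sum nbr s (site i) g / k%:R ^+ s.
Proof.
elim: s i => [|s IH] i.
  move=> _; rewrite expr0 divr1 (bigD1 i) //= big1 => [|j ji].
    by rewrite mxE eqxx mul1r addr0.
  by rewrite mxE eq_sym (negbTE ji) mul0r.
case/andP => iS /allP inn.
under eq_bigr => j _ do rewrite exprS mxE mulr_suml.
rewrite exchange_big /=.
transitivity (\sum_l stay_mx i l * (walk_sum nbr s (site l) g / k%:R ^+ s)).
  apply: eq_bigr => l _; have [->|Pil] := eqVneq (stay_mx i l) 0.
    by rewrite mul0r big1 // => j _; rewrite !mul0r.
  rewrite -IH; first by rewrite mulr_sumr; apply: eq_bigr => j _; rewrite mulrA.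
  (* With all neighbours in [S] the staying probability is zero, so a nonzero entry forces
     adjacency. *)
  apply: (inn); move: Pil; rewrite mxE; case: (site l \in _) => //.
  suff -> : count (fun w => w \notin S) (nbr (site i)) = 0%N.
    by rewrite muln0 mul0r eqxx.
  apply/eqP; rewrite -leqn0 leqNgt -has_count; apply/hasPn => w wn.
  by rewrite negbK (interior_mem (inn _ wn)).
rewrite (stay_mx_row (fun z => walk_sum nbr s z g / k%:R ^+ s)).
rewrite exprS invfM /= mulrCA mulr_suml; congr (_ * _).
apply: eq_big_seq => w wn.
by rewrite (interior_mem (inn _ wn)).
Qed.

Lemma stay_mx_pow_joined s i j :
  (stay_mx ^+ s) i j != 0 -> joined_in nbr S (site i) (site j).
Proof.
elim: s i => [|s IH] i.
  rewrite expr0 mxE; have [-> _|_] := eqVneq i j; last by rewrite eqxx.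
  by split; [exact: mem_site | exists [::]].
rewrite exprS mxE => neq0.
have [l /negP] : exists l, ~ (stay_mx i l * (stay_mx ^+ s) l j == 0).
  apply/existsNP => all0; case/negP: neq0; apply/eqP; apply: big1 => l _.
  exact/eqP/all0.
rewrite mulf_eq0 => /norP [/stay_mx_neq0 il /IH [lS [p [pp [lp pS]]]]].
split; first exact: mem_site.
case: il => [->|il]; first by exists p.
by exists (site l :: p); rewrite /= /adj il pp lp pS mem_site.
Qed.

(** Telescope along a path in [S], one edge at a time. *)
Lemma joined_rowspace i j : joined_in nbr S (site i) (site j) ->
  ((delta_mx 0 i - delta_mx 0 j : 'rV_N) <= (1 - stay_mx : 'M_N))%MS.
Proof.
case=> _ [p [pp [lp pS]]]; elim: p i pp lp pS => [|y p IH] i /=.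
  by move=> _ /site_inj -> _; rewrite subrr sub0mx.
case/andP => iy pp lp /andP [/siteP [l yl] pS]; subst y.
rewrite -(subrKA (delta_mx 0 l)) addmx_sub ?IH //.
apply: edge_rowspace => //.
- exact: stay_mx_sym.
- exact: stay_mx_ge0.
- exact: stay_mx_sum.
rewrite mxE mulf_neq0 ?invr_eq0 // pnatr_eq0 -lt0n.
by move: iy; rewrite /adj => ->.
Qed.

Definition res_mx (i j : 'I_N) : R :=
  k%:R^-1 * qform (pinvmx (1 - stay_mx)) (delta_mx 0 i - delta_mx 0 j).

Lemma res_mx_ub i j (f : V -> R) : joined_in nbr S (site i) (site j) ->
  0 < energy nbr S f ->
  (f (site i) - f (site j)) ^+ 2 / energy nbr S f <= res_mx i j.
Proof.
move=> /joined_rowspace gL; rewrite energyE => E0.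
have E1 : 0 < qform (1 - stay_mx) (\row_i f (site i)).
  by move: E0; rewrite pmulr_rgt0 // ltr0n.
rewrite /res_mx invfM mulrCA ler_pM2l ?invr_gt0 ?ltr0n //.
have := pinv_cauchy_schwarz stay_mx_sym stay_mx_ge0 stay_mx_sum gL E1.
by rewrite mulmx_delta_diff ![in X in X -> _]mxE.
Qed.

Lemma res_mx_ge0 i j : joined_in nbr S (site i) (site j) -> 0 <= res_mx i j.
Proof.
move=> /joined_rowspace gL; rewrite mulr_ge0 ?invr_ge0 ?ler0n // pinv_qform //.
apply: dirichlet_ge0.
- exact: stay_mx_sym.
- exact: stay_mx_ge0.
- exact: stay_mx_sum.
Qed.

End Compression.

(** * Effective resistance and return probabilities *)

Section Resistance.
Variables (R : realType) (V : eqType) (nbr : V -> seq V) (k : nat).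
Hypotheses (Hsimple : simple_graph nbr) (Hreg : regular nbr k).
Hypothesis k_gt0 : (0 < k)%N.
Implicit Types (S T : seq V) (f : V -> R).

Let k0 : 0 < (k%:R : R). Proof. by rewrite ltr0n. Qed.

Lemma energy_mono S T f : {subset S <= T} -> energy nbr S f <= energy nbr T f.
Proof.
move=> ST; rewrite /energy ler_pM2l ?invr_gt0 ?ltr0n //.
have -> (F : V -> R) :
    \sum_(u <- undup S) F u = \sum_(u <- undup T | u \in S) F u.
  rewrite -[RHS]big_filter; apply: perm_big; apply: uniq_perm.
  - exact: undup_uniq.
  - by rewrite filter_uniq ?undup_uniq.
  - move=> w; rewrite mem_filter !mem_undup andbC; apply/idP/andP => [wS|[]//].
    by rewrite wS (ST _ wS).
rewrite big_mkcond; apply: ler_sum => u _; case: ifP => _; last first.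
  by apply: sumr_ge0 => w _; rewrite sqr_ge0.
rewrite big_mkcond [leRHS]big_mkcond; apply: ler_sum => w _.
by case: ifP => [/ST ->//|_]; case: ifP => // _; rewrite sqr_ge0.
Qed.

(** Covers the functions that the supremum in [res_fin] leaves out. *)
Lemma energy0_joined S f x y : energy nbr S f = 0 -> joined_in nbr S x y ->
  f x = f y.
Proof.
move=> /eqP; rewrite mulf_eq0 invr_eq0 pnatr_eq0 /=.
rewrite psumr_eq0 => [/allP E0|u _]; last first.
  by apply: sumr_ge0 => w _; rewrite sqr_ge0.
have edge u w : u \in S -> w \in S -> w \in nbr u -> f u = f w.
  move=> uS wS wu; have := E0 u; rewrite mem_undup => /(_ uS) /=.
  rewrite psumr_eq0 => [/allP/(_ _ wu)|? _]; last by rewrite sqr_ge0.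
  by rewrite wS /= sqrf_eq0 subr_eq0 => /eqP.
case=> xS [p [pp [lp pS]]]; elim: p x xS pp lp pS => [|u p IH] x xS /=.
  by move=> _ ->.
case/andP => xu pp lp /andP [uS pS].
by rewrite (edge x u) // (IH u).
Qed.

Lemma res_fin_ge0 S x y : 0 <= res_fin R nbr S x y.
Proof.
rewrite /res_fin; set A := (X in sup X).
(* A set without a supremum has [sup] equal to 0 by convention. *)
have [hs|/sup_out -> //] := pselect (has_sup A).
have [z Az] := hs.1; apply: le_trans (sup_upper_bound hs Az).
by case: Az => f f0 <-; apply: divr_ge0 (sqr_ge0 _) (ltW f0).
Qed.

Lemma res_fin_le S i j :
  joined_in nbr S (@site _ S i) (@site _ S j) ->
  res_fin R nbr S (site i) (site j) <= res_mx R nbr k i j.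
Proof.
move=> ij; rewrite /res_fin; set A := (X in sup X).
have [->|A0] := eqVneq A set0%classic.
  by rewrite sup0 res_mx_ge0.
by apply: ge_sup => [|_ [f f0 <-]]; [exact/set0P|exact: res_mx_ub].
Qed.

(** The product form also covers zero energy. For positive energy, [res_mx] bounds the set of
    quotients, so its [sup] is a genuine upper bound. *)
Lemma res_fin_ge S x y f : joined_in nbr S x y ->
  (f x - f y) ^+ 2 <= res_fin R nbr S x y * energy nbr S f.
Proof.
move=> Sxy; have := energy_ge0 nbr S f.
rewrite le_eqVlt => /orP [/eqP E0|E0].
  by rewrite -E0 mulr0 (energy0_joined (esym E0) Sxy) subrr expr0n.
rewrite -ler_pdivrMr //; apply: ub_le_sup; last by exists f.
case: (Sxy) => /siteP [i xi] [p [pp [lp pS]]].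
have /siteP [j yj] : y \in S.
  by rewrite -lp; have /allP := pS; case: p {pp lp pS} => [|a p] /=;
    [rewrite -xi mem_site|apply; apply: mem_last].
exists (res_mx R nbr k i j) => _ [h h0 <-].
rewrite -xi -yj; apply: res_mx_ub => //; by rewrite xi yj.
Qed.

Lemma eff_res_le S x y : joined_in nbr S x y ->
  eff_res R nbr x y <= res_fin R nbr S x y.
Proof.
move=> Sxy; apply: ge_inf; last by exists S.
by exists 0 => _ [T _ <-]; apply: res_fin_ge0.
Qed.

Hypothesis Hconn : connected_graph nbr.

Lemma eff_res_ge b x y :
  (forall S, joined_in nbr S x y -> b <= res_fin R nbr S x y) ->
  b <= eff_res R nbr x y.
Proof.
move=> Hb; apply: lb_le_inf => [|_ [S Sxy <-]]; last exact: Hb.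
(* The infimum must range over a nonempty set; a path from [x] to [y] supplies a member. *)
have [p [pp lp]] := Hconn x y.
exists (res_fin R nbr (x :: p) x y); exists (x :: p) => //.
split; first exact: mem_head.
exists p; split => //; split => //; apply/allP => z zp.
by rewrite /= inE zp orbT.
Qed.

Lemma eff_res_ge0 x y : 0 <= eff_res R nbr x y.
Proof. by apply: eff_res_ge => S _; apply: res_fin_ge0. Qed.

Fixpoint ball s x : seq V :=
  if s is s'.+1 then x :: flatten [seq ball s' u | u <- nbr x] else [:: x].

Lemma interior_ball s x T : {subset ball s x <= T} -> interior nbr T s x.
Proof.
elim: s x => [|s IH] x xT /=; first by rewrite xT ?mem_head.
rewrite xT ?mem_head //=; apply/allP => u ux; apply: IH => z zu; apply: xT.
rewrite inE; apply/orP; right; apply/flattenP.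
by exists (ball s u); rewrite ?map_f.
Qed.

(** In such a window, finite matrix powers count the walks from [x] and [y] exactly, while every
    edge of [S] is retained. *)
Lemma interior_window n x y S : exists T (i j : 'I_(size (undup T))),
  [/\ site i = x, site j = y, {subset S <= T}, interior nbr T n x
    & interior nbr T n y].
Proof.
pose T := S ++ ball n x ++ ball n y.
have ix : interior nbr T n x.
  by apply: interior_ball => z zx; rewrite !mem_cat zx orbT.
have iy : interior nbr T n y.
  by apply: interior_ball => z zy; rewrite !mem_cat zy !orbT.
have [i xi] := siteP (interior_mem ix).
have [j yj] := siteP (interior_mem iy).
by exists T, i, j; split => // z zS; rewrite mem_cat zS.
Qed.

Lemma stay_mx_pow S s i j : interior nbr S s (@site _ S i) ->
  (stay_mx R nbr k S ^+ s) i j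
  = walk_sum nbr s (site i) (fun z => (z == site j)%:R) / k%:R ^+ s.
Proof.
move=> int_i; rewrite -(stay_mx_walk k Hsimple) // (bigD1 j) //= eqxx mulr1.
rewrite big1 ?addr0 // => l lj; rewrite (inj_eq (@site_inj _ S)) (negbTE lj).
by rewrite mulr0.
Qed.

Lemma walk_sum_sym s x y :
  walk_sum nbr s x (fun z => (z == y)%:R)
  = walk_sum nbr s y (fun z => (z == x)%:R) :> R.
Proof.
have [T [i [j [<- <- _ ix iy]]]] := interior_window s x y [::].
apply: (@mulIf _ (k%:R ^+ s)^-1); first by rewrite invr_eq0 expf_neq0 ?gt_eqF.
rewrite -!stay_mx_pow // -[in LHS](expmx_tr (stay_mx_sym _ _ Hsimple _)) mxE.
by [].
Qed.

(** * Lower bound for one resistance by a truncated Green function *)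

Hypothesis Htrans : vertex_transitive nbr.
Variable v : V.
Local Notation D s := (Delta R nbr v s).
Local Notation q s := (Delta R nbr v s / k%:R ^+ s).

Lemma qform_stay_mx T s i j : interior nbr T s (@site _ T i) ->
  interior nbr T s (@site _ T j) ->
  qform (stay_mx R nbr k T ^+ s) (delta_mx 0 i - delta_mx 0 j)
  = 2 * (D s - walk_sum nbr s (site j) (fun z => (z == site i)%:R)) / k%:R ^+ s.
Proof.
move=> ii ij; rewrite qform_delta !stay_mx_pow //.
rewrite -/(Delta R nbr (site i) s) -/(Delta R nbr (site j) s).
rewrite !(Delta_transitive R Hsimple s _ v) //.
rewrite [walk_sum _ _ (site i) _]walk_sum_sym.
by ring.
Qed.

(** Even powers are positive semidefinite; evaluate the form at a difference of two unit vectors. *)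
Lemma walk_sum_even_le b x :
  walk_sum nbr (b + b) x (fun z => (z == v)%:R) <= D (b + b).
Proof.
have [T [i [j [iv jx _ ii ij]]]] := interior_window (b + b) v x [::].
have := qform_even_ge0 (stay_mx_sym R k Hsimple T) b
  (delta_mx 0 i - delta_mx 0 j).
rewrite qform_stay_mx ?iv ?jx // pmulr_lge0 ?invr_gt0 ?exprn_gt0 //.
by rewrite pmulr_rge0 ?ltr0n // subr_ge0.
Qed.

(** The test function has potential drop [rho] and energy at most [rho], so the Dirichlet principle
    gives [rho ^+ 2 <= res_fin * rho]. *)
Lemma eff_res_lower b x : k%:R^-1 * \sum_(s < b + b)
   2 * (D s - walk_sum nbr s x (fun z => (z == v)%:R)) / k%:R ^+ s
  <= eff_res R nbr v x.
Proof.
apply: eff_res_ge => S Svx.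
have [T [i [j [iv jx ST ii ij]]]] := interior_window (b + b) v x S.
set P := stay_mx R nbr k T.
set g : 'rV[R]_(size (undup T)) := delta_mx 0 i - delta_mx 0 j.
have Psym : P^T = P by exact: stay_mx_sym.
have Psum := stay_mx_sum R Hsimple Hreg k_gt0 (S := T).
pose M := \sum_(s < b + b) P ^+ s; pose u := k%:R^-1 *: (g *m M).
pose rho : R := k%:R^-1 * qform M g.
have -> : k%:R^-1 * \sum_(s < b + b)
   2 * (D s - walk_sum nbr s x (fun z => (z == v)%:R)) / k%:R ^+ s = rho.
  congr (_ * _); rewrite qform_sum; apply: eq_bigr => s _.
  by rewrite qform_stay_mx ?iv ?jx //; apply: interior_leq (ltnW (ltn_ord s)) _.
(* [f] extends the vector [u] by zero outside [T]. *)
pose f z : R := \sum_l (site l == z)%:R * u 0 l.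
have fE l : f (site l) = u 0 l.
  rewrite /f (bigD1 l) //= eqxx mul1r big1 ?addr0 // => m ml.
  by rewrite (inj_eq (@site_inj _ T)) (negbTE ml) mul0r.
have frho : f v - f x = rho.
  rewrite -iv -jx !fE /rho /qform mulmx_delta_diff mulrBr.
  by rewrite /u; congr (_ - _); rewrite mxE.
have Erho : energy nbr S f <= rho.
  apply: le_trans (energy_mono f ST) _.
  rewrite (energyE Hsimple Hreg k_gt0) -/P.
  have -> : \row_l f (site l) = u by apply/rowP => l; rewrite mxE fE.
  rewrite /u qformZ expr2 /rho mulrA mulrA divff ?gt_eqF // mul1r.
  rewrite ler_pM2l ?invr_gt0 //.
  by apply: dirichlet_truncated_green => // l m; apply: stay_mx_ge0.
have := res_fin_ge f Svx; rewrite frho => rle.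
have rho0 : 0 <= rho := le_trans (energy_ge0 nbr S f) Erho.
have := rho0; rewrite le_eqVlt => /orP [/eqP <-|rho1]; first exact: res_fin_ge0.
rewrite -(ler_pM2r rho1) -expr2; apply: le_trans rle _.
by rewrite ler_wpM2l ?res_fin_ge0.
Qed.

Lemma walk_sum_ge_term s x w (h : V -> R) : (forall z, 0 <= h z) ->
  walk_sum nbr s x (fun z => (z == w)%:R) * h w <= walk_sum nbr s x h.
Proof.
move=> h0; rewrite mulrC -walk_sumZ; apply: le_walk_sum => z.
by case: eqVneq => [->|_]; rewrite ?mulr1 ?mulr0.
Qed.

Lemma Delta_even_add b t : D (t + (b + b)) <= k%:R ^+ t * D (b + b).
Proof.
rewrite /Delta walk_sum_cat -(walk_sum_cst Hreg t v).
by apply: le_walk_sum => z; apply: walk_sum_even_le.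
Qed.

Lemma le_sum_mem (r : seq V) (F : V -> R) y : (forall z, 0 <= F z) -> y \in r ->
  F y <= \sum_(z <- r) F z.
Proof.
by move=> F0 yr; rewrite (big_rem y) //= lerDl; apply: sumr_ge0.
Qed.

Lemma walk_sum_path x p : path (adj nbr) x p ->
  1 <= walk_sum nbr (size p) x (fun z => (z == last x p)%:R) :> R.
Proof.
elim: p x => [|y p IH] x /=; first by rewrite eqxx.
case/andP => xy /IH /le_trans; apply.
apply: (le_sum_mem (F := fun u => walk_sum nbr (size p) u _)) => // z.
by apply: walk_sum_ge0 => w; apply: ler0n.
Qed.

(** Prepend a step to some neighbour and back. *)
Lemma walk_sum_backtrack n x (g : V -> R) : (forall z, 0 <= g z) ->
  walk_sum nbr n x g <= walk_sum nbr n.+2 x g.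
Proof.
move=> g0; case: Hsimple => _ _ nsym.
have ws0 m y : 0 <= walk_sum nbr m y g by apply: walk_sum_ge0.
have : (0 < size (nbr x))%N by rewrite Hreg.
case En: (nbr x) => [//|u r] _; have ux : u \in nbr x by rewrite En mem_head.
apply: le_trans (le_sum_mem (F := fun y => walk_sum nbr n.+1 y g) _ ux) => //.
by apply: (le_sum_mem (F := fun y => walk_sum nbr n y g)) => //; rewrite -nsym.
Qed.

Lemma walk_sum_even_mono c d x (g : V -> R) : (forall z, 0 <= g z) ->
  (c <= d)%N -> walk_sum nbr (c + c) x g <= walk_sum nbr (d + d) x g.
Proof.
move=> g0 /subnK <-; elim: (d - c)%N => // e IH.
by apply: le_trans IH _; rewrite addSn addnS; apply: walk_sum_backtrack.
Qed.

(** * Decay of the even return probabilities *)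

Hypothesis Hinf : infinite_graph V.

(** Backtracking brings all the vertices to one common even length [c + c]. *)
Lemma many_even_reachable n : exists c (s : seq V), [/\ uniq s, size s = n &
  forall w, w \in s -> 1 <= walk_sum nbr (c + c) v (fun z => (z == w)%:R) :> R].
Proof.
elim: n => [|n [c [s [us sn cs]]]]; first by exists 0, [::].
have [[w [d [ws dw]]]|no] := pselect (exists w d, w \notin s /\
    1 <= walk_sum nbr (d + d) v (fun z => (z == w)%:R) :> R).
  exists (maxn c d), (w :: s); split; rewrite /= ?ws ?sn // => z.
  have ind0 y : forall z, 0 <= (z == y)%:R :> R by move=> ?; apply: ler0n.
  rewrite inE => /orP [/eqP ->|/cs /le_trans]; last first.
    by apply; apply: walk_sum_even_mono; rewrite ?leq_maxl.
  by apply: le_trans dw _; apply: walk_sum_even_mono; rewrite ?leq_maxr.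
(* If [s] cannot be extended, every vertex lies in [s] or next to it, according to the parity of a
   path from [v], and the graph is finite. *)
have even_s p : path (adj nbr) v p -> ~~ odd (size p) -> last v p \in s.
  move=> pp ep; apply/negPn/negP => ls; apply: no.
  exists (last v p), (size p)./2; split => //.
  by rewrite addnn halfK (negbTE ep) subn0; apply: walk_sum_path.
case: Hinf; exists (s ++ flatten [seq nbr u | u <- s]) => x.
have [p [pp <-]] := Hconn v x; rewrite mem_cat.
have [|/(even_s _ pp) ->//] := boolP (odd (size p)).
elim/last_ind: p pp => [//|p y _]; rewrite rcons_path size_rcons last_rcons.
case/andP => pp ly /= ep; apply/orP; right; apply/flattenP.
by exists (nbr (last v p)) => //; apply: map_f; apply: even_s.
Qed.

Lemma return_prob_even_small eps : 0 < eps -> exists b, q (b + b)%N < eps.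
Proof.
move=> eps0; apply: contrapT => no.
have qge b : eps <= q (b + b)%N.
  by rewrite leNgt; apply/negP => lt; apply: no; exists b.
(* More than [2 / eps] vertices of probability at least [eps / 2] will exceed total mass 1. *)
have [n n_eps] : exists n : nat, 1 < n%:R * (eps / 2).
  exists (Num.bound (2 / eps)); rewrite mulrA ltr_pdivlMr // mul1r.
  by rewrite -ltr_pdivrMr //; apply: archi_boundP; rewrite divr_ge0 ?ltW.
have [c [s [us sn cs]]] := many_even_reachable n.
pose A : set R := [set x | exists b, x = q (b + b)%N]%classic.
have lbA : has_lbound A by exists eps => _ [b ->].
have infA : has_inf A by split; first by exists (q (0 + 0)%N), 0%N.
have kp m : 0 < (k%:R : R) ^+ m by rewrite exprn_gt0.
(* This tolerance becomes [eps / 2] once multiplied by the number of walks of length [c + c]. *)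
have eta0 : 0 < eps / 2 / k%:R ^+ (c + c) by rewrite !divr_gt0.
have [_ [b ->] qb] := inf_adherent eta0 infA.
have qbc : q ((c + b) + (c + b))%N > q (b + b)%N - eps / 2 / k%:R ^+ (c + c).
  rewrite ltrBlDr; apply: lt_le_trans qb _; rewrite lerD2r.
  by apply: ge_inf => //; exists (c + b)%N.
have pw w : w \in s ->
    eps / 2 <= walk_sum nbr (b + b) v (fun z => (z == w)%:R) / k%:R ^+ (b + b).
  move=> ws; rewrite walk_sum_sym.
  set a := walk_sum _ _ _ _.
  (* The deficit [h] is nonnegative and its sum over walks of length [c + c] is small; one of these
     walks ends at [w], so [h w] is small. *)
  pose h z : R := D (b + b) - walk_sum nbr (b + b) z (fun y => (y == v)%:R).
  have h0 z : 0 <= h z by rewrite subr_ge0 walk_sum_even_le.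
  have hw : h w <= k%:R ^+ (c + c) * D (b + b) - D ((c + b) + (c + b))%N.
    apply: le_trans (_ : walk_sum nbr (c + c) v h <= _); last first.
      rewrite addnACA (@eq_walk_sum _ _ _ _ _ _ (fun z => D (b + b)
        + -1 * walk_sum nbr (b + b) z (fun y => (y == v)%:R))) => [|z].
        rewrite walk_sumD (walk_sum_cst Hreg) walk_sumZ -walk_sum_cat.
        by rewrite mulN1r.
      by rewrite mulN1r.
    apply: le_trans (walk_sum_ge_term _ _ w h0).
    by rewrite -[leLHS]mul1r ler_wpM2r ?cs.
  rewrite ler_pdivlMr //; have := qge b; rewrite ler_pdivlMr // => Db.
  have Dbc : k%:R ^+ (c + c) * D (b + b) - eps / 2 * k%:R ^+ (b + b)
             < D ((c + b) + (c + b))%N.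
    move: qbc; rewrite ltr_pdivlMr //; apply: le_lt_trans.
    rewrite addnACA [k%:R ^+ (c + c + (b + b))]exprD.
    move: (kp (c + c)%N) (kp (b + b)%N); move: (_ ^+ _) (_ ^+ _) => K L K0 L0.
    by rewrite le_eqVlt; apply/orP; left; apply/eqP; field; rewrite !gt_eqF.
  by move: hw; rewrite /h -/a; lra.
have : n%:R * (eps / 2) <= 1.
  rewrite -sn -sum1_size natr_sum mulr_suml.
  apply: le_trans (_ : \sum_(w <- s)
    walk_sum nbr (b + b) v (fun z => (z == w)%:R) / k%:R ^+ (b + b) <= _).
    by rewrite !big_seq; apply: ler_sum => w ws; rewrite mul1r pw.
  rewrite -mulr_suml ler_pdivrMr // mul1r -walk_sum_sum.
  rewrite -[leRHS]mulr1 -(walk_sum_cst Hreg _ v); apply: le_walk_sum => z.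
  rewrite -natr_sum lern1.
  rewrite (eq_bigr (fun w => if w == z then 1 else 0)%N) => [|w _].
    by rewrite -big_mkcond sum1_count count_uniq_mem // leq_b1.
  by rewrite eq_sym; case: eqP.
by rewrite leNgt n_eps.
Qed.

(** Both sides are the sum of the first [m] terms plus that of the first [n], minus that of the
    first [m + n]. *)
Lemma sum_shift_exchange (f : nat -> R) m n :
  \sum_(s < m) (f s - f (n + s)%N) = \sum_(s < n) (f s - f (m + s)%N).
Proof.
have E a b : \sum_(s < a + b) f s = \sum_(s < a) f s + \sum_(s < b) f (a + s)%N.
  by rewrite big_split_ord.
by rewrite !sumrB; have := E m n; rewrite addnC E; lra.
Qed.

Variable r : nat.
Hypothesis r_gt0 : (0 < r)%N.
Local Notation W := (walk_sum nbr r v (eff_res R nbr v)).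

Lemma walk_sum_eff_res_lower b :
  2 * k%:R ^+ r.-1 * (\sum_(s < r) q s - r%:R * q (b + b)%N) <= W.
Proof.
have := @le_walk_sum _ _ nbr r v _ _ (fun x => eff_res_lower b x).
apply: le_trans.
rewrite walk_sumZ walk_sum_sum.
have -> : \sum_(s < b + b) walk_sum nbr r v (fun x =>
     2 * (D s - walk_sum nbr s x (fun z => (z == v)%:R)) / k%:R ^+ s)
   = 2 * k%:R ^+ r * \sum_(s < b + b) (q s - q (r + s)%N).
  rewrite mulr_sumr; apply: eq_bigr => s _.
  rewrite (@eq_walk_sum _ _ _ _ _ _ (fun x => 2 / k%:R ^+ s * (D s
     + -1 * walk_sum nbr s x (fun z => (z == v)%:R)))); last first.
    by move=> x; rewrite mulN1r mulrAC.
  rewrite walk_sumZ walk_sumD (walk_sum_cst Hreg) walk_sumZ -walk_sum_cat.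
  rewrite -/(Delta R nbr v _) exprD.
  by field; rewrite !expf_neq0 ?gt_eqF.
have -> : k%:R^-1 * (2 * k%:R ^+ r * \sum_(s < b + b) (q s - q (r + s)%N))
          = 2 * k%:R ^+ r.-1 * \sum_(s < b + b) (q s - q (r + s)%N).
  by rewrite -{1}(prednK r_gt0) exprS; field; rewrite gt_eqF.
rewrite ler_wpM2l ?mulr_ge0 ?exprn_ge0 ?ler0n //.
(* Exchanging the shifts leaves only [r] terms, each with an error [q (b + b + s)] that is at most
   [q (b + b)]. *)
rewrite (sum_shift_exchange (fun s => q s)) sumrB lerD2l lerN2.
have -> : r%:R * q (b + b)%N = \sum_(s < r) q (b + b)%N.
  by rewrite sumr_const card_ord mulr_natl.
apply: ler_sum => s _; rewrite [(b + b + s)%N]addnC exprD invfM mulrA.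
rewrite ler_pM2r ?invr_gt0 ?exprn_gt0 // ler_pdivrMr ?exprn_gt0 // mulrC.
exact: Delta_even_add.
Qed.

Lemma walk_sum_eff_res_ge : 2 * k%:R ^+ r.-1 * \sum_(s < r) q s <= W.
Proof.
have kr : 0 < 2 * (k%:R : R) ^+ r.-1 * r%:R.
  by rewrite !mulr_gt0 ?exprn_gt0 ?ltr0n.
apply/ler_addgt0Pr => eps eps0.
have [b qb] := return_prob_even_small (divr_gt0 eps0 kr).
apply: le_trans (lerD (walk_sum_eff_res_lower b) (lexx eps)).
move: (ltW qb); rewrite ler_pdivlMr // -subr_ge0.
move=> H; rewrite -subr_ge0; apply: (le_trans H).
by rewrite le_eqVlt; apply/orP; left; apply/eqP; ring.
Qed.

(** * Upper bound by averaging over a finite vertex set *)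

Section Upper.
Variable S : seq V.
Local Notation N := (size (undup S)).
Local Notation P := (stay_mx R nbr k S).
Local Notation near s := (\sum_(i < N) (~~ interior nbr S s (site i))%:R : R).

Fixpoint layer_const s : nat :=
  if s is s'.+1 then (k * layer_const s').+1 else 0.

(** A vertex that is not [s.+1]-interior is in the boundary or has a neighbour in [S] that is not
    [s]-interior. As columns of [P] sum to one, the second kind costs a factor [k], whence the
    recursion of [layer_const]. *)
Lemma sum_not_interior s :
  near s <= (layer_const s)%:R * (size (boundary nbr S))%:R.
Proof.
elim: s => [|s IH].
  by rewrite big1 ?mul0r // => i _; rewrite /= mem_site.
pose F x : R := (~~ interior nbr S s x)%:R.
have F0 x : 0 <= F x by apply: ler0n.
have step i : (~~ interior nbr S s.+1 (site i))%:R
    <= (has (fun w => w \notin S) (nbr (site i)))%:R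
       + k%:R * \sum_j P i j * F (site j).
  rewrite (stay_mx_row _ Hsimple) mulVKf ?gt_eqF // /= mem_site /=.
  have [nbrS|nbrS] := boolP (has _ _).
    apply: le_trans (_ : 1 <= _); first by rewrite lern1 leq_b1.
    by rewrite lerDl; apply: sumr_ge0 => w _; case: ifP.
  rewrite add0r; have [_|/allPn [w wn nw]] := boolP (all _ _).
    by apply: sumr_ge0 => w _; case: ifP.
  apply: le_trans (le_sum_mem _ wn); last by move=> z; case: ifP.
  move/hasPn: nbrS => /(_ _ wn); rewrite negbK => ->.
  by rewrite /F nw.
apply: le_trans (ler_sum _ (fun i _ => step i)) _.
rewrite big_split /= -mulr_sumr exchange_big /=.
have -> : \sum_(i < N) (has (fun w => w \notin S) (nbr (site i)))%:R
          = (size (boundary nbr S))%:R :> R.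
  rewrite -(sum_site _ (fun x => (has (fun w => w \notin S) (nbr x))%:R)).
  rewrite -natr_sum size_filter -sum1_count [in RHS]big_mkcond /=.
  by congr (_%:R); apply: eq_bigr => u _; case: has.
have -> : \sum_(j < N) \sum_(i < N) P i j * F (site j) = near s.
  apply: eq_bigr => j _; rewrite -mulr_suml -[RHS]mul1r; congr (_ * _).
  rewrite -[RHS](stay_mx_sum R Hsimple Hreg k_gt0 j); apply: eq_bigr => i _.
  by rewrite -{1}(stay_mx_sym R k Hsimple S) mxE.
rewrite -natr1 natrM mulrDl mul1r addrC lerD2r -mulrA.
by rewrite ler_wpM2l ?ler0n.
Qed.

Lemma sum_interior s :
  \sum_(i < N) (interior nbr S s (site i))%:R = N%:R - near s.
Proof.
apply/eqP; rewrite eq_sym subr_eq -big_split /= -[X in X%:R]card_ord.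
rewrite -sum1_card natr_sum.
by apply/eqP/eq_bigr => i _; case: interior; rewrite ?addr0 ?add0r.
Qed.

(** Interior diagonal entries are return probabilities; the others are at most 1. *)
Lemma mxtrace_stay_mx_pow s : (s < r)%N ->
  \tr (P ^+ s) <= (N%:R - near r) * q s + near r.
Proof.
move=> sr; rewrite -sum_interior.
rewrite mulr_suml -big_split; apply: ler_sum => i _ /=.
have [ii|_] := boolP (interior nbr S r (site i)).
  rewrite mul1r addr0 stay_mx_pow; last exact: interior_leq (ltnW sr) ii.
  by rewrite -/(Delta R nbr _ s) (Delta_transitive R Hsimple s _ v).
rewrite mul0r add0r; apply: expmx_le1; first exact: stay_mx_ge0.
exact: stay_mx_sum.
Qed.

Lemma walk_sum_eff_res_finite : (N%:R - near r) * W
  <= 2 * k%:R ^+ r.-1 * ((N%:R - near r) * \sum_(s < r) q s + r%:R * near r).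
Proof.
have kr0 : 0 < (k%:R : R) ^+ r by rewrite exprn_gt0.
have mean i : (interior nbr S r (site i))%:R * (W / k%:R ^+ r)
    <= \sum_j (P ^+ r) i j * res_mx R nbr k i j.
  (* A nonzero entry joins the two sites inside [S], where [eff_res <= res_fin <= res_mx]. *)
  have term j : 0 <= (P ^+ r) i j * eff_res R nbr (site i) (site j)
     <= (P ^+ r) i j * res_mx R nbr k i j.
    have [->|/stay_mx_pow_joined ij] := eqVneq ((P ^+ r) i j) 0.
      by rewrite !mul0r lexx.
    have p0 : 0 <= (P ^+ r) i j by apply: expmx_ge0; apply: stay_mx_ge0.
    rewrite mulr_ge0 ?eff_res_ge0 //= ler_wpM2l //.
    by apply: le_trans (eff_res_le ij) (res_fin_le ij).
  have [ii|_] := boolP (interior nbr S r (site i)); last first.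
    rewrite mul0r; apply: sumr_ge0 => j _.
    by case/andP: (term j) => a b; apply: le_trans b.
  rewrite mul1r (walk_sum_eff_res_transitive R Hsimple r v (site i)) //.
  rewrite -(stay_mx_walk k Hsimple) //; apply: ler_sum => j _.
  by case/andP: (term j).
have := @ler_sum _ _ (index_enum 'I_N) xpredT _ _ (fun i _ => mean i).
rewrite -mulr_suml sum_interior.
rewrite mulrA ler_pdivrMr // => /le_trans; apply.
have -> : \sum_(i < N) \sum_j (P ^+ r) i j * res_mx R nbr k i j
  = k%:R^-1 * \sum_(i < N) \sum_j (P ^+ r) i j
     * qform (pinvmx (1 - P)) (delta_mx 0 i - delta_mx 0 j).
  rewrite mulr_sumr; apply: eq_bigr => i _; rewrite mulr_sumr.
  by apply: eq_bigr => j _; rewrite mulrCA.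
have := sum_expmx_pinv (stay_mx_sym R k Hsimple S)
          (stay_mx_sum R Hsimple Hreg k_gt0 (S := S)) r.
set X := \sum_(i < N) _ => HX.
have -> : k%:R^-1 * X * k%:R ^+ r = X * k%:R ^+ r.-1.
  by rewrite -{1}(prednK r_gt0) exprS; field; rewrite gt_eqF.
rewrite [leRHS]mulrAC ler_wpM2r ?exprn_ge0 ?ler0n //.
apply: le_trans HX _; rewrite ler_pM2l ?ltr0n //.
have -> : (N%:R - near r) * \sum_(s < r) q s + r%:R * near r
          = \sum_(s < r) ((N%:R - near r) * q s + near r).
  by rewrite big_split /= -mulr_sumr sumr_const card_ord mulr_natl.
by apply: ler_sum => s _; apply: mxtrace_stay_mx_pow.
Qed.

End Upper.

Lemma smallish_exhaustion_mem (Gm : nat -> seq V) m n x :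
  (forall m x, x \in Gm m -> x \in Gm m.+1) -> (m <= n)%N ->
  x \in Gm m -> x \in Gm n.
Proof.
by move=> inc /subnK <- xm; elim: (n - m)%N => // d; apply: inc.
Qed.

Lemma walk_sum_eff_res_le : smallish R nbr ->
  W <= 2 * k%:R ^+ r.-1 * \sum_(s < r) q s.
Proof.
move=> [Gm [inc exh small]]; set B := leRHS.
rewrite leNgt; apply/negP => BW; pose d := W - B.
have d0 : 0 < d by rewrite subr_gt0.
pose a : R := 2 * k%:R ^+ r.-1 * r%:R.
have a0 : 0 <= a by rewrite !mulr_ge0 ?exprn_ge0 ?ler0n.
pose C : R := (layer_const r)%:R.
have C0 : 0 <= C by apply: ler0n.
(* A boundary ratio below [d / ((a + d) * C + 1)] contradicts [N * d <= (a + d) * (C * bd)]; the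
   added 1 keeps the denominator positive. *)
have den0 : 0 < (a + d) * C + 1.
  by rewrite ltr_wpDl ?ltr01 // mulr_ge0 // addr_ge0 // ltW.
have [M HM] := small _ (divr_gt0 d0 den0).
(* Going past [m0] makes [Gm m] nonempty; for an empty set the ratio would be 0 by the convention on
   division. *)
have [m0 vm0] := exh v.
pose m := maxn M m0; have := HM m (leq_maxl _ _).
have vm : v \in Gm m by apply: smallish_exhaustion_mem vm0; rewrite ?leq_maxr.
set N : R := (size (undup (Gm m)))%:R; set bd : R := (size (boundary _ _))%:R.
have N0 : 0 < N.
  by rewrite ltr0n; move: vm; rewrite -mem_undup; case: (undup _).
have bd0 : 0 <= bd by apply: ler0n.
rewrite ltr_pdivrMr // mulrAC ltr_pdivlMr // => small_bd.
pose nr : R :=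
  \sum_(i < size (undup (Gm m))) (~~ interior nbr (Gm m) r (site i))%:R.
have nr_bd : nr <= C * bd := sum_not_interior (Gm m) r.
have fin : (N - nr) * W <= 2 * k%:R ^+ r.-1
    * ((N - nr) * \sum_(s < r) q s + r%:R * nr).
  exact: walk_sum_eff_res_finite.
have : N * d <= (a + d) * (C * bd).
  apply: le_trans (_ : (a + d) * nr <= _); last first.
    by rewrite ler_wpM2l // addr_ge0 // ltW.
  move: fin; rewrite /d /a /B.
  move: (2 * _ : R) (\sum_(s < r) _ : R) (W : R) => K Q W'.
  by clearbody nr N; lra.
by move: small_bd; clearbody bd N C a d; lra.
Qed.

End Resistance.

Theorem theorem2 (R : realType) (V : eqType) (nbr : V -> seq V) (k : nat)
  (Hsimple : simple_graph nbr) (Hreg : regular nbr k)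
  (Hinf : infinite_graph V) (Hconn : connected_graph nbr)
  (Htrans : vertex_transitive nbr) (Hsmall : smallish R nbr)
  (v : V) (r : nat) (hr : (0 < r)%N) :
  walk_sum nbr r v (fun j => eff_res R nbr v j)
  = 2 * (k%:R : R) ^+ r.-1 * \sum_(s < r) Delta R nbr v s / (k%:R : R) ^+ s.
Proof.
(* A connected graph of degree 0 would be the single vertex [v]. *)
have k_gt0 : (0 < k)%N.
  rewrite lt0n; apply/negP => /eqP k0; apply: Hinf; exists [:: v] => x.
  have [[|y p] [/= + <-]] := Hconn v x; first by rewrite mem_head.
  by rewrite /adj (size0nil (etrans (Hreg v) k0)).
apply/eqP; rewrite eq_le; apply/andP; split.
  exact: walk_sum_eff_res_le.
exact: walk_sum_eff_res_ge.
Qed.
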